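(* Let $X=\{x_1,\ldots,x_N\}$ and $Y=\{y_1,\ldots,y_N\}$ be two point clouds of the same size. Let $c_1,c_2\in\mathbb{R}$ with $c_1\ne0$ and $c_2\ne0$. Let $X_{c_1}=\{c_1x_1,\ldots,c_1x_N\}$ be the point cloud with each point in $X$ scaled by a factor of $c_1$, and let $Y_{c_2}=\{c_2y_1,\ldots,c_2y_N\}$ be the point cloud with each point in $Y$ scaled by a factor of $c_2$. Then $\mathrm{LNSA}^{\mathrm{metric}}(X,Y)=\mathrm{LNSA}^{\mathrm{metric}}(X_{c_1},Y_{c_2})$.
   Context: A point cloud is a set $X=\{x_1,\ldots,x_N\}\subseteq\mathbb{R}^n$, with points indexed by $1,\ldots,N$. $d(\cdot,\cdot)$ is Euclidean distance. Let $k$ be the number of nearest neighbours considered. For an index $i$, $kNN_X(i)=(i_1,\ldots,i_k)$ means that the $k$ nearest neighbours of $x_i$ in $X$ are $(x_{i_1},\ldots,x_{i_k})$. For any $k$-tuple of indices $(i_1,\ldots,i_k)$, the approximate dimensionality of $x_i$ is $$\mathrm{AD}_X(i,(i_1,\ldots,i_k))=-\left(\frac1k\sum_{j=1}^k\log\frac{d(x_i,x_{i_j})}{d(x_i,x_{i_k})}\right)^{-1}.$$ Set $\mathrm{lid}(i,X)=\mathrm{AD}_X(i,kNN_X(i))$ and, for point clouds $X,Y$ of the same size $N$ (possibly in different dimensions), $\overline{\mathrm{lid}}_X(i,Y)=\mathrm{AD}_Y(i,kNN_X(i))$. Define $$\mathrm{LNSA}_Y(X)=\frac1N\sum_{i=1}^N\left(\mathrm{lid}(i,Y)^{-1}-\overline{\mathrm{lid}}_Y(i,X)^{-1}\right)^2,\qquad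 \mathrm{LNSA}^{\mathrm{metric}}(X,Y)=\mathrm{LNSA}_X(Y)+\mathrm{LNSA}_Y(X).$$ *)

(* Defs.v *)
From mathcomp Require Import all_boot all_order all_algebra all_fingroup.
From mathcomp Require Import reals exp.

Set Implicit Arguments.
Unset Strict Implicit.
Unset Printing Implicit Defensive.

Import Order.TTheory GRing.Theory Num.Theory.
Local Open Scope ring_scope.

(* The norm that MathComp-Analysis puts on row vectors is the sup norm, hence
   this explicit Euclidean distance. *)
Definition edist (R : realType) (n : nat) (x y : 'rV[R]_n) : R :=
  Num.sqrt (\sum_(j < n) (x 0 j - y 0 j) ^+ 2).

(* A point cloud of size N in R^n is an injective map 'I_N -> 'rV[R]_n;
   injectivity is a hypothesis of the theorem, not part of the type. *)
Definition scale_cloud (R : realType) (N n : nat) (c : R)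
    (X : 'I_N -> 'rV[R]_n) : 'I_N -> 'rV[R]_n :=
  fun i => c *: X i.

(* Comparison of the candidate neighbours j and l of the i-th point. The rank
   tie i, an arbitrary linear order on the indices, only decides between
   equidistant candidates. *)
Definition nearer (R : realType) (N n : nat) (tie : 'I_N -> 'S_N)
    (X : 'I_N -> 'rV[R]_n) (i : 'I_N) : rel 'I_N :=
  fun j l =>
    (edist (X i) (X j) < edist (X i) (X l))
    || ((edist (X i) (X j) == edist (X i) (X l)) && (tie i j <= tie i l)%N).

Definition neighbours (R : realType) (N n : nat) (tie : 'I_N -> 'S_N)
    (X : 'I_N -> 'rV[R]_n) (i : 'I_N) : seq 'I_N :=
  sort (nearer tie X i) [seq j <- enum 'I_N | j != i].

(* There are N.-1 candidates, so the default value i of nth is not used when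
   k < N. *)
Definition kNN (R : realType) (N n k : nat) (tie : 'I_N -> 'S_N)
    (X : 'I_N -> 'rV[R]_n) (i : 'I_N) : k.-tuple 'I_N :=
  [tuple nth i (neighbours tie X i) j | j < k].

(* For 0 < k, last i t is the k-th entry of t. If the logarithms sum to 0 (for
   instance if k = 1), then AD is 0^-1 = 0 instead of being infinite; in both
   readings its inverse, the only value that LNSA uses, is 0. *)
Definition AD (R : realType) (N n k : nat) (X : 'I_N -> 'rV[R]_n) (i : 'I_N)
    (t : k.-tuple 'I_N) : R :=
  - (k%:R^-1 * \sum_(j < k) ln (edist (X i) (X (tnth t j))
                                / edist (X i) (X (last i t))))^-1.

Definition lid (R : realType) (N n k : nat) (tie : 'I_N -> 'S_N) (i : 'I_N)
    (X : 'I_N -> 'rV[R]_n) : R :=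
  AD X i (kNN k tie X i).

(* lid_bar k tie X i Y measures Y at the neighbours taken from X. *)
Definition lid_bar (R : realType) (N n m k : nat) (tie : 'I_N -> 'S_N)
    (X : 'I_N -> 'rV[R]_n) (i : 'I_N) (Y : 'I_N -> 'rV[R]_m) : R :=
  AD Y i (kNN k tie X i).

(* LNSA k tie Y X is LNSA_Y(X): the subscript comes first. *)
Definition LNSA (R : realType) (N n m k : nat) (tie : 'I_N -> 'S_N)
    (Y : 'I_N -> 'rV[R]_m) (X : 'I_N -> 'rV[R]_n) : R :=
  N%:R^-1 *
  \sum_(i < N) ((lid k tie i Y)^-1 - (lid_bar k tie Y i X)^-1) ^+ 2.

Definition LNSA_metric (R : realType) (N n m k : nat) (tie : 'I_N -> 'S_N)
    (X : 'I_N -> 'rV[R]_n) (Y : 'I_N -> 'rV[R]_m) : R :=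
  LNSA k tie X Y + LNSA k tie Y X.

(* Main.v *)
Require Import Defs.
From mathcomp Require Import all_boot all_order all_algebra all_fingroup.
From mathcomp Require Import boolp reals exp.

Set Implicit Arguments.
Unset Strict Implicit.
Unset Printing Implicit Defensive.

Import Order.TTheory GRing.Theory Num.Theory.
Local Open Scope ring_scope.

(** Scaling by [c] multiplies all distances in a cloud by [|c| > 0]. This keeps their order, hence
    the neighbours ([kNN_scale]), and cancels in the ratios inside [AD] ([AD_scale]). No ratio mixes
    the two clouds, so they may be scaled by unrelated factors. *)

Lemma edistZ (R : realType) (n : nat) (c : R) (x y : 'rV[R]_n) :
  edist (c *: x) (c *: y) = `|c| * edist x y.
Proof.
rewrite /edist -sqrtr_sqr -sqrtrM ?sqr_ge0// mulr_sumr.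
by congr Num.sqrt; apply: eq_bigr => j _; rewrite !mxE -mulrBr exprMn.
Qed.

(** Multiplication by [|c|] is strictly increasing, so strict comparisons and ties both survive; the
    rank [tie] sees only indices. *)
Lemma nearer_scale (R : realType) (N n : nat) (tie : 'I_N -> 'S_N) (c : R)
    (X : 'I_N -> 'rV[R]_n) (i j l : 'I_N) :
  c != 0 -> nearer tie (scale_cloud c X) i j l = nearer tie X i j l.
Proof.
move=> c0; have c_gt0 : 0 < `|c| by rewrite normr_gt0.
rewrite /nearer /scale_cloud !edistZ ltr_pM2l//.
by rewrite (inj_eq (mulfI (lt0r_neq0 c_gt0))).
Qed.

Lemma kNN_scale (R : realType) (N n k : nat) (tie : 'I_N -> 'S_N) (c : R)
    (X : 'I_N -> 'rV[R]_n) (i : 'I_N) :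
  c != 0 -> kNN k tie (scale_cloud c X) i = kNN k tie X i.
Proof.
move=> c0; rewrite /kNN /neighbours.
(* The unsorted candidates depend on [i] alone, so only the sorting relation is at stake. *)
suff -> : nearer tie (scale_cloud c X) i = nearer tie X i by [].
by apply/funext => j; apply/funext => l; exact: nearer_scale.
Qed.

(** The tuple [t] is arbitrary because [lid_bar] uses neighbours taken from the other cloud. *)
Lemma AD_scale (R : realType) (N n k : nat) (c : R) (X : 'I_N -> 'rV[R]_n)
    (i : 'I_N) (t : k.-tuple 'I_N) :
  c != 0 -> AD (scale_cloud c X) i t = AD X i t.
Proof.
move=> c0; rewrite /AD; do 3 congr (_ _); apply: eq_bigr => j _.
(* The factor [|c| / |c|] splits off even over a zero distance, since [x / 0 = 0]. *)
by rewrite /scale_cloud !edistZ -mulf_div divff ?normr_eq0// mul1r.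
Qed.

Lemma LNSA_scale (R : realType) (N n m k : nat) (tie : 'I_N -> 'S_N) (c d : R)
    (Y : 'I_N -> 'rV[R]_m) (X : 'I_N -> 'rV[R]_n) :
  c != 0 -> d != 0 ->
  LNSA k tie (scale_cloud c Y) (scale_cloud d X) = LNSA k tie Y X.
Proof.
move=> c0 d0; congr (_ * _); apply: eq_bigr => i _.
by rewrite /lid /lid_bar kNN_scale// !AD_scale.
Qed.

Theorem lemmaE3 (R : realType) (N n m k : nat) (hk0 : (0 < k)%N)
    (hkN : (k < N)%N) (tie : 'I_N -> 'S_N)
    (X : 'I_N -> 'rV[R]_n) (Y : 'I_N -> 'rV[R]_m)
    (hX : injective X) (hY : injective Y)
    (c1 c2 : R) (hc1 : c1 != 0) (hc2 : c2 != 0) :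
  LNSA_metric k tie X Y
  = LNSA_metric k tie (scale_cloud c1 X) (scale_cloud c2 Y).
Proof. by rewrite /LNSA_metric !LNSA_scale. Qed.
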